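(* Let $\mathbb{F}_q$ be a finite field of characteristic greater than five, and let $K$ be a cyclic (i.e. Galois) cubic extension of $\mathbb{F}_q(t)$ with full constant field $\mathbb{F}_q$ and unit rank two. Suppose that $K$ has $k$-exceptional units in the following sense: there is a unit $\varepsilon\in\mathcal{O}_K^*$ with $\varepsilon\notin\mathbb{F}_q^*$ which is a root of a polynomial $x^3+Px^2+A_0x+c$ with $P,A_0\in\mathbb{F}_q[t]$, $\deg P\ge 1$, $\deg A_0\ge 1$, $c\in\mathbb{F}_q^*$, and there is $k\in\mathbb{F}_q^*$ such that $\varepsilon+k$ is also a unit of $\mathcal{O}_K$ with $\varepsilon+k\notin\mathbb{F}_q^*$. Then $K$ is given by the minimal polynomial $x^3-Ax^2-(A+3)x-1$ for some $A\in\mathbb{F}_q[t]$ with $\deg(A)\ge 1$, i.e. $K=\mathbb{F}_q(t)(\eta)$ for a root $\eta$ of this polynomial.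
   Context: $\mathcal{O}_K$ denotes the integral closure of $\mathbb{F}_q[t]$ in $K$ (the maximal order), and $\mathcal{O}_K^*$ its unit group. The unit rank of $K$ is $s-1$, where $s$ is the number of places of $K$ lying above the infinite place of $\mathbb{F}_q(t)$ (the place corresponding to $1/t$). A pair of units $\epsilon,\tau$ of $K$ is called $k$-exceptional if $\tau=\epsilon+k$ with $k\in\mathbb{F}_q^*$. *)

(* Defs.v *)
From HB Require Import structures.
From mathcomp Require Import all_boot all_order all_algebra all_fingroup all_field.
From mathcomp Require Import classical_sets cardinality.

Set Implicit Arguments.
Unset Strict Implicit.
Unset Printing Implicit Defensive.

Import GRing.Theory.
Local Open Scope ring_scope.
Local Open Scope classical_set_scope.

Notation ratfun F := {fraction {poly F}}.

Definition polyK (F : fieldType) (K : fieldExtType (ratfun F))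
    (f : {poly F}) : K :=
  (FracField.tofrac f)%:A.

Definition constK (F : fieldType) (K : fieldExtType (ratfun F)) (a : F) : K :=
  polyK K a%:P.

Definition full_constant_field (F : fieldType) (K : fieldExtType (ratfun F)) :=
  forall x : K, algebraicOver (@constK F K) x -> range (@constK F K) x.

Definition maximal_order (F : fieldType) (K : fieldExtType (ratfun F)) : set K :=
  [set x | integralOver (@polyK F K) x].

Definition order_unit (F : fieldType) (K : fieldExtType (ratfun F)) : set K :=
  [set x | [/\ x != 0, maximal_order x & maximal_order x^-1]].

(* Valuation ring of the place of F(t) at infinity, i.e. deg f <= deg g; here
   [size] is one more than the degree, and is 0 for the zero polynomial. *)
Definition infinity_ring (F : fieldType) : set (ratfun F) :=
  [set x | exists f g : {poly F},
     [/\ g != 0, (size f <= size g)%N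
       & x = FracField.tofrac f / FracField.tofrac g]].

(* A place of the function field K/F is represented by its valuation ring, which
   determines it: a ring F < O < K such that z or z^-1 lies in O for every z
   (for z = 0 both are 0, which lies in O). *)
Definition valuation_ring (F : fieldType) (K : fieldExtType (ratfun F))
    (O : set K) :=
  [/\ range (@constK F K) `<` O, O `<` [set: K],
      forall x y, O x -> O y -> O (x - y),
      forall x y, O x -> O y -> O (x * y)
    & forall z, O z \/ O z^-1].

Definition infinite_places (F : fieldType) (K : fieldExtType (ratfun F)) :
    set (set K) :=
  [set O | valuation_ring O /\ in_alg K @^-1` O = @infinity_ring F].

Definition has_unit_rank (F : fieldType) (K : fieldExtType (ratfun F))
    (r : nat) :=
  exists s : nat,
    [/\ (0 < s)%N, (@infinite_places F K #= `I_s)%card & r = (s - 1)%N].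

Definition exceptional_pair (F : fieldType) (K : fieldExtType (ratfun F))
    (k : F) (eps tau : K) :=
  [/\ k != 0, order_unit eps, order_unit tau & tau = eps + constK K k].

(* Main.v *)
(** Put eta := eps / k, so that eta and eta + 1 are units and eta is a root of
    x^3 + a x^2 + b x + c with a in F[t] nonconstant. The norm of eta + 1 is a
    constant, hence b = a + d with d in F. As the extension is cyclic, the
    discriminant D(a) is a square in F[t], where D is a monic quartic over F
    depending on c and d only. Write D = R^2 S with S separable; then S(a) = z^2
    and, differentiating, z divides a' because S(a) and S'(a) are coprime. If S
    is not constant, deg z >= deg a forces a' = z' = 0, so that a and z are
    polynomials in t^p and a descent on deg a gives a contradiction. Therefore D
    is a square in F[X], and comparing coefficients yields c = -1, d = -3. *)

Require Import Defs.
From HB Require Import structures.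
From mathcomp Require Import all_boot all_order all_algebra all_fingroup all_field.
From mathcomp Require Import boolp classical_sets cardinality.
From mathcomp Require Import cyclic ring zify.

Set Implicit Arguments.
Unset Strict Implicit.
Unset Printing Implicit Defensive.

Import GRing.Theory.
Local Open Scope ring_scope.

(** * Squares among composites [D \Po P], then the quartic [disc_poly] *)

Section PolynomialSquares.

Variable F : fieldType.
Implicit Types P R S D f g y z : {poly F}.

Lemma deriv_eq0_comp_Xn p f : p \in [pchar F] -> f^`() = 0 ->
  exists g, f = g \Po 'X^p.
Proof.
move=> charFp f'0; have p_gt0 := prime_gt0 (pcharf_prime charFp).
exists (\poly_(i < size f) f`_(i * p)); apply/polyP=> i.
rewrite coef_comp_poly_Xn // coef_poly; case: ifPn => [/divnK->|p'i].
  case: ltnP => // le_fi; rewrite nth_default //.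
  exact: leq_trans le_fi (leq_div _ _).
case: i p'i => [|i] p'i; first by rewrite dvdn0 in p'i.
have /eqP := congr1 (fun h : {poly F} => h`_i) f'0.
rewrite coef_deriv coef0 -mulr_natr mulf_eq0 -(dvdn_pcharf charFp).
by rewrite (negPf p'i) orbF => /eqP.
Qed.

Lemma comp_poly_inj g : (1 < size g)%N -> injective (fun f => f \Po g).
Proof.
move=> g_gt1 f h /eqP.
by rewrite -subr_eq0 -comp_polyB comp_poly_eq0 // subr_eq0 => /eqP.
Qed.

(** Degree at least 2 for [S] is what gives [deg z >= deg P]. The descent keeps [S] fixed and
    replaces [P] and [z] by polynomials whose composites with ['X^p] they are. *)
Lemma separable_comp_square p S P z : p \in [pchar F] -> (2 < p)%N ->
  separable_poly S -> (2 < size S)%N -> S \Po P = z ^+ 2 -> (size P <= 1)%N.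
Proof.
move=> charFp p_gt2 sepS S_gt2; have p_pr := pcharf_prime charFp.
have nz2 : 2%:R != 0 :> F by rewrite -(dvdn_pcharf charFp) gtnNdvd.
have [n le_n] := ubnP (size P); elim: n => // n IHn in P z le_n * => DSP.
rewrite leqNgt; apply/negP=> P_gt1.
have sz_z : (((size S).-1 * (size P).-1) = (size z).-1 * 2)%N.
  by rewrite -size_comp_poly DSP size_exp.
have nz_z : z != 0 by apply/eqP=> z0; move: sz_z; rewrite z0 size_poly0; nia.
have der : z *+ 2 * z^`() = (S^`() \Po P) * P^`().
  by rewrite -deriv_comp DSP expr2 derivM mulrnAl mulr2n mulrC.
(* A Bezout relation between [S] and its derivative survives composition with [P]. So the composed
   derivative is coprime to [S \Po P = z ^+ 2], hence to [z]. *)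
have z_dvd : z %| P^`().
  rewrite -(@Gauss_dvdpr _ _ (S^`() \Po P)).
    by rewrite -der mulrnAl -mulrnAr dvdp_mulIl.
  rewrite -(@coprimep_pexpl _ 2) // -DSP; apply/Bezout_coprimepP.
  have := sepS; rewrite unlock => /Bezout_coprimepP[[u v] /= uv1].
  exists (u \Po P, v \Po P) => /=; rewrite -!comp_polyM -comp_polyD.
  move: uv1; rewrite -!size_poly_eq1 => /size_poly1P[a nz_a ->].
  by rewrite comp_polyC size_polyC nz_a.
have P'0 : P^`() = 0.
  apply: contraTeq z_dvd => nz_P'; rewrite gtNdvdp //.
  have ltP' : (size P^`() < size P)%N by rewrite lt_size_deriv // -size_poly_gt0; lia.
  apply: leq_trans ltP' _; rewrite -(prednK (ltnW P_gt1)) (@leq_trans (size z).-1.+1) //.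
    by rewrite ltnS; nia.
  by rewrite prednK // size_poly_gt0.
have z'0 : z^`() = 0.
  move/eqP: der; rewrite P'0 mulr0 mulf_eq0 -mulr_natr mulf_eq0 (negPf nz_z).
  by rewrite -polyC_natr polyC_eq0 (negPf nz2) => /eqP.
have [Q DP] := deriv_eq0_comp_Xn charFp P'0.
have [w Dz] := deriv_eq0_comp_Xn charFp z'0.
have Xp_gt1 : (1 < size ('X^p : {poly F}))%N by rewrite size_polyXn; lia.
have szP : (size P).-1 = ((size Q).-1 * p)%N.
  by rewrite DP size_comp_poly size_polyXn.
(* Since [deg P = p * deg Q], a constant [Q] contradicts [P_gt1]; the same equality makes [Q]
   smaller than [P], as the induction needs. *)
suff : (size Q <= 1)%N by nia.
apply: (IHn _ w); first by nia.
by apply: (comp_poly_inj Xp_gt1); rewrite /= -comp_polyA -DP DSP Dz rmorphXn.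
Qed.

(** Square factors are split off until none remains. The bound [deg D < p] then excludes
    inseparability: a nonconstant divisor with zero derivative is a polynomial in ['X^p], of degree
    at least [p]. *)
Lemma square_separable_decomposition p D : p \in [pchar F] -> D != 0 ->
  (size D <= p)%N -> exists R S, D = R ^+ 2 * S /\ separable_poly S.
Proof.
move=> charFp; have [n le_n] := ubnP (size D).
elim: n => // n IHn in D le_n * => nzD leDp.
have [sepD | ] := boolP (separable_poly D).
  by exists 1, D; rewrite expr1n mul1r.
have [sqfD /negP[]|] := pselect (forall u : {poly F}, size u != 1%N -> ~~ (u ^+ 2 %| D)).
  apply/separable_polyP; split; first exact/poly_square_freeP.
  move=> u u_dvd u_gt1; apply/eqP=> u'0.
  have [g Du] := deriv_eq0_comp_Xn charFp u'0.
  have sz_u : ((size u).-1 = (size g).-1 * p)%N.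
    by rewrite Du size_comp_poly size_polyXn.
  have arith (a b d : nat) :
    (1 < a -> a.-1 = b * p -> a <= d -> d <= p -> False)%N.
    by case: b => [|b]; rewrite ?mul0n ?mulSn; lia.
  exact: arith u_gt1 sz_u (dvdp_leq nzD u_dvd) leDp.
move=> /existsNP[u /not_implyP[u_neq1 /negP/negPn]] /dvdpP[E DE] _.
have nzE : E != 0 by apply: contraNneq nzD => E0; rewrite DE E0 mul0r.
have nzu : u != 0 by apply: contraNneq nzD => u0; rewrite DE u0 expr0n mulr0.
have ltED : (size E < size D)%N.
  have u_gt0 : (0 < size u)%N by rewrite size_poly_gt0.
  have u2_gt0 : (0 < size (u ^+ 2))%N by rewrite size_poly_gt0 expf_neq0.
  have arith (a b d : nat) : (0 < a -> 0 < b -> a != 1 -> b.-1 = a.-1 * 2 ->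
    d < (d + b).-1)%N by lia.
  rewrite DE size_mul ?expf_neq0 //.
  exact: arith u_gt0 u2_gt0 u_neq1 (size_exp u 2).
have [R [S [DRS sepS]]] :=
  IHn E (leq_trans ltED le_n) nzE (leq_trans (ltnW ltED) leDp).
by exists (u * R), S; rewrite DE DRS; split=> //; ring.
Qed.

(** Cancelling the square of [R \Po P] leaves [S \Po P] a square, so [deg S <= 1]. An odd size of
    [D] means an even degree, which rules out [deg S = 1]. *)
Lemma comp_square_is_square p D P y : p \in [pchar F] -> (2 < p)%N ->
    D \is monic -> (size D <= p)%N -> odd (size D) -> (1 < size P)%N ->
  D \Po P = y ^+ 2 -> exists2 R, R \is monic & D = R ^+ 2.
Proof.
move=> charFp p_gt2 monD leDp oddD P_gt1 DPy.
have nzD := monic_neq0 monD.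
have [R [S [DRS sepS]]] := square_separable_decomposition charFp nzD leDp.
have nzR : R != 0 by apply: contraNneq nzD => R0; rewrite DRS R0 expr0n mul0r.
have nzS := separable_poly_neq0 sepS.
have nzRP : R \Po P != 0 by rewrite comp_poly_eq0.
have [z SPz] : exists z, S \Po P = z ^+ 2.
  have /dvdpP[z Dy] : R \Po P %| y.
    by rewrite -(@dvdp_pexp2r _ _ _ 2) // -DPy DRS comp_polyM rmorphXn dvdp_mulIl.
  exists z; apply: (mulfI (expf_neq0 2 nzRP)).
  by rewrite -rmorphXn -comp_polyM -DRS DPy Dy exprMn mulrC rmorphXn.
have S_le2 : (size S <= 2)%N.
  rewrite leqNgt; apply/negP=> S_gt2.
  by have := separable_comp_square charFp p_gt2 sepS S_gt2 SPz; rewrite leqNgt P_gt1.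
have /size_poly1P[s nzs DS] : size S == 1%N.
  have arith (a b d : nat) : (0 < a -> 0 < b -> 0 < d -> d <= 2 ->
    b.-1 = a.-1 * 2 -> odd (b + d).-1 -> d == 1)%N by lia.
  have := oddD; rewrite DRS size_mul ?expf_neq0 //.
  by apply: (arith (size R)); rewrite ?size_exp // size_poly_gt0 ?expf_neq0.
have lcR : lead_coef R != 0 by rewrite lead_coef_eq0.
(* Monicity of [D] forces [s * lead_coef R ^+ 2 = 1], so normalizing [R] absorbs the constant
   [s]. *)
exists ((lead_coef R)^-1 *: R); first by rewrite monicE lead_coefZ mulVf.
move/monicP: (monD); rewrite DRS DS lead_coefM lead_coefC lead_coef_exp => lcD.
rewrite exprZn mulrC mul_polyC; congr (_ *: _).
by apply: (mulfI (expf_neq0 2 lcR)); rewrite lcD exprVn divff ?expf_neq0.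
Qed.

(* The discriminant of x^3 + a x^2 + (a + d) x + c as a polynomial in a. *)
Definition disc_poly (c d : F) : {poly F} :=
  'X^2 * ('X + d%:P) ^+ 2 - 4%:R * ('X + d%:P) ^+ 3 - 4%:R * c%:P * 'X^3
  - 27%:R * c%:P ^+ 2 + 18%:R * c%:P * 'X * ('X + d%:P).

Lemma disc_polyE c d : disc_poly c d =
  'X^4 + Poly [:: - 4%:R * d ^+ 3 - 27%:R * c ^+ 2;
                  - 12%:R * d ^+ 2 + 18%:R * d * c;
                  d ^+ 2 - 12%:R * d + 18%:R * c;
                  d *+ 2 - 4%:R - 4%:R * c].
Proof. rewrite /disc_poly /= !cons_poly_def; ring. Qed.

Lemma size_disc_poly c d : size (disc_poly c d) = 5.
Proof.
by rewrite disc_polyE size_polyDl size_polyXn // ltnS (size_Poly [:: _; _; _; _]).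
Qed.

Lemma monic_disc_poly c d : disc_poly c d \is monic.
Proof.
rewrite monicE disc_polyE lead_coefDl ?lead_coefXn //.
by rewrite size_polyXn ltnS (size_Poly [:: _; _; _; _]).
Qed.

(* With e := c - 1 - d, the comparison of coefficients reduces to
   (c + e) (c + 1) (e - 1) = 0 and v^2 = - 4 d^3 - 27 c^2. *)
Lemma disc_square_coefs (c d u v : F) : 2%:R != 0 :> F -> c != 0 ->
    - 4%:R * d ^+ 3 - 27%:R * c ^+ 2 - v ^+ 2 = 0 ->
    - 12%:R * d ^+ 2 + 18%:R * d * c - 2%:R * u * v = 0 ->
    d ^+ 2 - 12%:R * d + 18%:R * c - u ^+ 2 - 2%:R * v = 0 ->
    d *+ 2 - 4%:R - 4%:R * c - 2%:R * u = 0 ->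
  c = -1 /\ d = - 3%:R.
Proof.
move=> nz2 nzc E0 E1 E2 E3.
have nz4 : 4%:R != 0 :> F by rewrite (natrM _ 2 2) mulf_neq0.
have [e Dd] : exists e : F, d = c - 1 - e by exists (c - 1 - d); ring.
(* [E3] is linear in [u], and [E2] is then linear in [v]; both are solved by cancelling 2. *)
have Du : u = d - 2%:R - 2%:R * c.
  have H : 2%:R * u = 2%:R * (d - 2%:R - 2%:R * c) :> F.
    by rewrite -[LHS]addr0 -E3; ring.
  exact: mulfI nz2 _ _ H.
have Dv : v = (2%:R - c) * (1 + 2%:R * e).
  have H : 2%:R * v = 2%:R * ((2%:R - c) * (1 + 2%:R * e)) :> F.
    by rewrite -[LHS]addr0 -E2 Du Dd; ring.
  exact: mulfI nz2 _ _ H.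
have H1 : 4%:R * ((c + e) * (c + 1) * (e - 1)) = 0 :> F.
  by rewrite -[RHS]oppr0 -E1 Du Dv Dd; ring.
suff [Dc De] : c = -1 /\ e = 1 by rewrite Dd De Dc; split=> //; ring.
(* In each case [E0] becomes 4 times a cube, with an extra factor [c] in the first, and every branch
   ends at [c = -1], [e = 1]. *)
move/eqP: H1; rewrite mulf_eq0 (negPf nz4) /= !mulf_eq0 -orbA => /or3P[] /eqP H.
- have De : e = - c by rewrite -[RHS]addr0 -H; ring.
  have /eqP : 4%:R * c * (c + 1) ^+ 3 = 0 :> F.
    by rewrite -[RHS]oppr0 -E0 Dv Dd De; ring.
  rewrite mulf_eq0 expf_eq0 /= mulf_eq0 (negPf nz4) (negPf nzc) /= addr_eq0.
  move=> /eqP Dc.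
  by rewrite De Dc opprK.
- have Dc : c = -1 by apply/eqP; rewrite -addr_eq0 H.
  have /eqP : 4%:R * (e - 1) ^+ 3 = 0 :> F by rewrite -E0 Dv Dd Dc; ring.
  by rewrite mulf_eq0 (negPf nz4) /= expf_eq0 /= subr_eq0 => /eqP.
have De : e = 1 by apply/eqP; rewrite -subr_eq0 H.
have /eqP : 4%:R * (c + 1) ^+ 3 = 0 :> F.
  by rewrite -[RHS]oppr0 -E0 Dv Dd De; ring.
by rewrite mulf_eq0 (negPf nz4) /= expf_eq0 /= addr_eq0 => /eqP.
Qed.

(** By degree, [R] is a monic quadratic with unknown coefficients [u] and [v]. The one surviving
    solution is [R = X^2 - 3 X + 9]. *)
Lemma disc_poly_square (c d : F) R : 2%:R != 0 :> F -> c != 0 ->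
  R \is monic -> disc_poly c d = R ^+ 2 -> c = -1 /\ d = - 3%:R.
Proof.
move=> nz2 nzc monR DR.
have szR : size R = 3.
  have arith (a : nat) : (5.-1 = a.-1 * 2 -> a = 3)%N by lia.
  by apply: arith; rewrite -size_exp -DR size_disc_poly.
have [u [v DRuv]] : exists u v : F, R = 'X^2 + u%:P * 'X + v%:P.
  exists R`_1, R`_0; apply/polyP=> -[|[|[|i]]];
    rewrite !coefD coefCM coefXn coefX coefC ?mulr0 ?mulr1 ?addr0 ?add0r //=.
    by move/monicP: monR; rewrite lead_coefE szR.
  by rewrite nth_default // szR.
have /polyP coefE : disc_poly c d - R ^+ 2 = 0 by rewrite DR subrr.
have DE : disc_poly c d - R ^+ 2 = Poly
   [:: - 4%:R * d ^+ 3 - 27%:R * c ^+ 2 - v ^+ 2;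
       - 12%:R * d ^+ 2 + 18%:R * d * c - 2%:R * u * v;
       d ^+ 2 - 12%:R * d + 18%:R * c - u ^+ 2 - 2%:R * v;
       d *+ 2 - 4%:R - 4%:R * c - 2%:R * u].
  rewrite disc_polyE DRuv /= !cons_poly_def; ring.
move: (coefE 0) (coefE 1) (coefE 2) (coefE 3); rewrite DE !coef_Poly !coef0 /=.
exact: disc_square_coefs.
Qed.

End PolynomialSquares.

(** * Integral closedness of [F[t]] in [F(t)] *)

Section RationalFunctions.

Variable F : fieldType.

Lemma ratfun_quotient (x : ratfun F) : exists n d : {poly F},
  [/\ d != 0, coprimep n d & x * FracField.tofrac d = FracField.tofrac n].
Proof.
have [n [d [nz_d Dx]]] : exists n d : {poly F},
    d != 0 /\ x * FracField.tofrac d = FracField.tofrac n.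
  elim/quotW: x => x; exists (frac x).1, (frac x).2.
  split; first exact: denom_ratioP.
  unlock FracField.tofrac; rewrite -[LHS]FracField.pi_mul.
  apply/eqmodP; rewrite /= FracField.equivfE /FracField.mulf.
  by rewrite !numden_Ratio ?mulr1 ?mulf_neq0 ?oner_neq0 ?denom_ratioP // mulrC.
have nz_g : gcdp n d != 0 by rewrite gcdp_eq0 negb_and nz_d orbT.
exists (n %/ gcdp n d), (d %/ gcdp n d); split.
- by rewrite dvdp_div_eq0 ?dvdp_gcdr.
- by rewrite coprimep_div_gcd ?nz_d ?orbT.
have nz_gF : FracField.tofrac (gcdp n d) != 0 by rewrite tofrac_eq0.
apply: (mulIf nz_gF); rewrite -mulrA -!tofracM.
by rewrite !divpK ?dvdp_gcdl ?dvdp_gcdr.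
Qed.

(** The rational root argument: the reduced denominator divides a power of the numerator, so it is
    constant. *)
Lemma ratfun_integrally_closed (x : ratfun F) :
  integralOver (@FracField.tofrac {poly F}) x ->
  exists f, x = FracField.tofrac f.
Proof.
move=> [q mon_q /rootP qx0]; have [n [d [nz_d co_nd Dx]]] := ratfun_quotient x.
have nz_dF : FracField.tofrac d != 0 by rewrite tofrac_eq0.
pose m := (size q).-1; have szq : size q = m.+1.
  by rewrite prednK // size_poly_gt0 monic_neq0.
(* The integral equation of [n / d] is multiplied by [d ^+ m]. Each lower term has [i < m] and so
   keeps a factor [d]; pulling one out leaves the exponent [(m - i).-1]. *)
have homog : n ^+ m + d * (\sum_(i < m) q`_i * n ^+ i * d ^+ (m - i).-1) = 0.
  apply/eqP; rewrite -tofrac_eq0 -(mul0r (FracField.tofrac d ^+ m)) -qx0.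
  rewrite horner_coef size_map_inj_poly ?tofrac0 //; last first.
    by move=> f g /eqP; rewrite tofrac_eq => /eqP.
  rewrite szq big_ord_recr /= !coef_map /=.
  rewrite -[q`_m]/(lead_coef q) (monicP mon_q) rmorph1 mul1r mulrDl.
  rewrite -exprMn Dx addrC tofracD tofracXn; apply/eqP; congr (_ + _).
  rewrite tofracM rmorph_sum mulr_sumr mulr_suml; apply: eq_bigr => i _.
  rewrite coef_map /= !tofracM !tofracXn -Dx exprMn.
  have -> : FracField.tofrac d ^+ m = FracField.tofrac d ^+ i *
     (FracField.tofrac d * FracField.tofrac d ^+ (m - i).-1).
    by rewrite -exprS prednK ?subn_gt0 // -exprD subnKC // ltnW.
  ring.
have d_unit : d %| 1.
  have: d %| n ^+ m by rewrite -dvdpNr (addr0_eq homog) dvdp_mulIl.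
  by rewrite -{1}[n ^+ m]mulr1 Gauss_dvdpr // coprimep_expr // coprimep_sym.
move: d_unit; rewrite dvdp1 => /size_poly1P[a nz_a Dd].
exists (a^-1 *: n); apply: (mulIf nz_dF); rewrite Dx -tofracM; congr (FracField.tofrac _).
by rewrite Dd mulrC mul_polyC scalerA mulfV // scale1r.
Qed.

End RationalFunctions.

(** * The maximal order and its units *)

Section MaximalOrder.

Variables (F : fieldType) (K : fieldExtType (ratfun F)).
Implicit Types x y : K.

Fact polyK_is_zmod_morphism : zmod_morphism (@polyK F K).
Proof. by move=> f g; rewrite /polyK tofracB scalerBl. Qed.

Fact polyK_is_monoid_morphism : monoid_morphism (@polyK F K).
Proof.
by split=> [|f g]; rewrite /polyK ?tofrac1 ?scale1r // tofracM -in_algE rmorphM.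
Qed.

HB.instance Definition _ := GRing.isZmodMorphism.Build {poly F} K (@polyK F K)
  polyK_is_zmod_morphism.
HB.instance Definition _ := GRing.isMonoidMorphism.Build {poly F} K (@polyK F K)
  polyK_is_monoid_morphism.

Lemma polyK_inj : injective (@polyK F K).
Proof. by move=> f g /(fmorph_inj (in_alg K))/eqP; rewrite tofrac_eq => /eqP. Qed.

Lemma polyK_in1 f : polyK K f \in 1%VS.
Proof. exact: rpredZ (mem1v _). Qed.

Lemma maximal_order_in1 x : maximal_order x -> x \in 1%VS ->
  exists f, x = polyK K f.
Proof.
move=> [q mon_q rt_q] /vlineP[r Dx]; have [|f Dr] := @ratfun_integrally_closed F r.
  exists q => //; move: rt_q; rewrite Dx.
  by rewrite (map_poly_comp (in_alg K) (@FracField.tofrac _)) -in_algE fmorph_root.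
by exists f; rewrite Dx Dr.
Qed.

(** Both [x] and its inverse come from [F[t]], whose units are the nonzero constants. This later
    turns the norm of a unit into an element of [F]. *)
Lemma order_unit_in1 x : order_unit x -> x \in 1%VS ->
  exists2 a : F, a != 0 & x = constK K a.
Proof.
move=> [nz_x int_x int_Vx] Fx; have [f Df] := maximal_order_in1 int_x Fx.
have [|g Dg] := maximal_order_in1 int_Vx; first by rewrite rpredV.
have fg1 : f * g = 1.
  by apply: polyK_inj; rewrite rmorphM rmorph1 /= -Df -Dg divff.
have : size (f * g) == 1%N by rewrite fg1 size_poly1.
rewrite size_mul_eq1 => /andP[/size_poly1P[a nz_a Dfa] _].
by exists a; rewrite // Df Dfa.
Qed.

Lemma order_unitM x y : order_unit x -> order_unit y -> order_unit (x * y).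
Proof.
move=> [nzx ix iVx] [nzy iy iVy]; split; first exact: mulf_neq0.
  exact: integral_mul.
by rewrite invfM; apply: integral_mul.
Qed.

Lemma constKV (a : F) : constK K a^-1 = (constK K a)^-1.
Proof.
have [-> | nz_a] := eqVneq a 0; first by rewrite /constK invr0 !rmorph0 invr0.
have nz_aK : constK K a != 0 by rewrite (raddf_eq0 _ polyK_inj) polyC_eq0.
apply: (mulfI nz_aK).
by rewrite divff // /constK -rmorphM -polyCM divff // polyC1 rmorph1.
Qed.

Lemma order_unit_const (a : F) : a != 0 -> order_unit (constK K a).
Proof.
move=> nz_a; split; first by rewrite (raddf_eq0 _ polyK_inj) polyC_eq0.
  exact: integral_id.
by rewrite -constKV; apply: integral_id.
Qed.

(** Linearity makes [s] fix the coefficients of an integral equation, so [s x] satisfies the same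
    equation as [x]. *)
Lemma maximal_order_aut (s : {lrmorphism K -> K}) x :
  maximal_order x -> maximal_order (s x).
Proof.
move=> [q mon_q rt_q]; exists q => //.
have -> : map_poly (@polyK F K) q = map_poly s (map_poly (@polyK F K) q).
  rewrite -map_poly_comp; apply: eq_map_poly => f /=.
  by rewrite /polyK linearZ rmorph1.
by rewrite fmorph_root.
Qed.

Lemma order_unit_aut (s : {lrmorphism K -> K}) x :
  order_unit x -> order_unit (s x).
Proof.
move=> [nzx ix iVx]; split; first by rewrite fmorph_eq0.
  exact: maximal_order_aut.
by rewrite -fmorphV; apply: maximal_order_aut.
Qed.

End MaximalOrder.

(** * Cyclic cubic extensions, Vieta and the discriminant *)

(** A group of prime order 3 is cyclic, and what its generator fixes is fixed by all powers, hence
    lies in the base field. *)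
Lemma cyclic_cubic_generator (F0 : fieldType) (L : splittingFieldType F0) :
  \dim {:L} = 3 -> galois 1 {:L} -> exists s : 'AEnd(L),
    (forall x, s (s (s x)) = x) /\ (forall x, s x = x -> x \in 1%VS).
Proof.
move=> dimL galL; have cardG : #|'Gal({:L} / 1)%g| = 3.
  by rewrite -galois_dim // dimL dimv1 divn1.
have /cyclicP[s Gs] : cyclic 'Gal({:L} / 1)%g by apply: prime_cyclic; rewrite cardG.
exists s; split=> [x|x sx].
  rewrite -!galM ?memvf //.
  have -> : (s * (s * s) = 1)%g by rewrite -(expg_order s) orderE -Gs cardG.
  by rewrite gal_id.
have <- : fixedField 'Gal({:L} / 1)%g = 1%VS by apply/galois_fixedField.
apply/fixedFieldP=> [|t]; first exact: memvf.
rewrite Gs => /cycleP[i ->]; elim: i => [|i IHi]; first by rewrite gal_id.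
by rewrite expgSr galM ?memvf // IHi.
Qed.

(** Divided differences: subtracting two equations and cancelling the difference of the roots lowers
    the degree. Doing so twice isolates [a]; then [b] and [c] follow by substitution. *)
Lemma cubic_vieta (L : fieldType) (a b c x y z : L) :
    x != y -> y != z -> z != x ->
    (forall t, t \in [:: x; y; z] -> t ^+ 3 + a * t ^+ 2 + b * t + c = 0) ->
  [/\ a = - (x + y + z), b = x * y + y * z + z * x & c = - (x * y * z)].
Proof.
move=> xy yz zx rts.
have rx := rts x (mem_head _ _).
have ry : y ^+ 3 + a * y ^+ 2 + b * y + c = 0 by apply: rts; rewrite !inE eqxx orbT.
have rz : z ^+ 3 + a * z ^+ 2 + b * z + c = 0 by apply: rts; rewrite !inE eqxx !orbT.
have E1 : x ^+ 2 + x * y + y ^+ 2 + a * (x + y) + b = 0.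
  apply: (@mulfI _ (x - y)); first by rewrite subr_eq0.
  by rewrite mulr0 -[RHS](subrr 0) -{1}rx -ry; ring.
have E2 : z ^+ 2 + z * y + y ^+ 2 + a * (z + y) + b = 0.
  apply: (@mulfI _ (z - y)); first by rewrite subr_eq0 eq_sym.
  by rewrite mulr0 -[RHS](subrr 0) -{1}rz -ry; ring.
have E3 : x + y + z + a = 0.
  apply: (@mulfI _ (z - x)); first by rewrite subr_eq0.
  by rewrite mulr0 -[RHS](subrr 0) -{1}E2 -E1; ring.
have Da : a = - (x + y + z) by rewrite -[LHS]addr0 -[RHS]add0r -{2}E3; ring.
have Db : b = x * y + y * z + z * x by rewrite -[RHS]addr0 -E1 Da; ring.
by split=> //; rewrite -[RHS]addr0 -rx Da Db; ring.
Qed.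

(** The right-hand side is the classical discriminant of the monic cubic with coefficients [a], [b],
    [c]. *)
Lemma disc_poly_comp (F : fieldType) (c d : F) (a : {poly F}) (b := a + d%:P) :
  disc_poly c d \Po a = a ^+ 2 * b ^+ 2 - 4%:R * b ^+ 3 - 4%:R * a ^+ 3 * c%:P
    - 27%:R * c%:P ^+ 2 + 18%:R * a * b * c%:P.
Proof.
rewrite /disc_poly rmorphD !rmorphB !rmorphM !rmorph_nat /=.
by rewrite !comp_polyD comp_polyX !comp_polyC /b; ring.
Qed.

Section CyclicCubic.

Variables (F : fieldType) (p : nat) (K : splittingFieldType (ratfun F)).
Hypotheses (charF : p \in [pchar F]) (p_gt5 : (5 < p)%N).
Hypotheses (cubicK : \dim {:K} = 3) (galoisK : galois 1 {:K}).

(** The case [k = 1], to which the theorem reduces by scaling. The two equations pin down the cubic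
    up to the free parameter [a]. *)
Lemma exceptional_unit_simplest (x : K) (a b : {poly F}) (c : F) :
    order_unit x -> order_unit (x + 1) -> x \notin 1%VS -> (1 < size a)%N ->
    c != 0 -> x ^+ 3 + polyK K a * x ^+ 2 + polyK K b * x + constK K c = 0 ->
  b = a - 3%:R /\ c = -1.
Proof.
move=> ux ux1 F'x a_gt1 nz_c rt_x.
have [s [s3 fix_s]] := cyclic_cubic_generator cubicK galoisK.
have sK f : s (polyK K f) = polyK K f by rewrite /polyK linearZ rmorph1.
pose y := s x; pose z := s y.
have xy : x != y by apply: contraNneq F'x => xy; apply: fix_s; rewrite -/y -xy.
have yz : y != z by rewrite (inj_eq (fmorph_inj s)).
have zx : z != x.
  by apply: contra_neqN xy => /eqP/(congr1 s); rewrite /z /y s3.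
have rt_s t : t ^+ 3 + polyK K a * t ^+ 2 + polyK K b * t + constK K c = 0 ->
  s t ^+ 3 + polyK K a * s t ^+ 2 + polyK K b * s t + constK K c = 0.
  move/(congr1 s); rewrite rmorph0 !rmorphD !rmorphM /=.
  by rewrite !sK.
have rt_y := rt_s _ rt_x; have rt_z := rt_s _ rt_y.
have [|Da Db Dc] := cubic_vieta xy yz zx (a := polyK K a) (b := polyK K b)
  (c := constK K c).
  by move=> t; rewrite !inE => /or3P[] /eqP->.
(* This is the norm of [x + 1]: a unit, and in [F(t)] because [s] permutes its factors. *)
have [e nz_e De] : exists2 e : F, e != 0 & (x + 1) * (y + 1) * (z + 1) = constK K e.
  have Dy : y + 1 = s (x + 1) by rewrite rmorphD rmorph1.
  have Dz : z + 1 = s (y + 1) by rewrite rmorphD rmorph1.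
  apply: order_unit_in1.
    by rewrite Dz Dy; do ?[apply: order_unitM | apply: order_unit_aut].
  by apply: fix_s; rewrite !rmorphM !rmorphD rmorph1 /= /z /y s3; ring.
(* By Vieta the norm expands to [e = 1 - a + b - c], which is solved for [b - a]. *)
pose d := e - 1 + c.
have Dbd : b = a + d%:P.
  apply: (@polyK_inj _ K).
  have -> : polyK K (a + d%:P) = polyK K a + constK K e - 1 + constK K c.
    by rewrite /constK /d; ring.
  by rewrite -De Da Db Dc; ring.
pose D := disc_poly c d.
(* The square root of the discriminant is the product of the root differences. It is integral, and
   fixed by [s] because a 3-cycle is an even permutation. *)
have [w Dw] : exists w, D \Po a = w ^+ 2.
  have [||w Dw] := @maximal_order_in1 _ K ((x - y) * (y - z) * (z - x)).
  - have [_ ix _] := ux; have iy := maximal_order_aut s ix.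
    have iz := maximal_order_aut s iy.
    by do ![apply: integral_mul | apply: integral_sub].
  - by apply: fix_s; rewrite !rmorphM !rmorphB /= /z /y s3; ring.
  exists w; apply: (@polyK_inj _ K).
  rewrite [RHS]rmorphXn /= -Dw disc_poly_comp -Dbd.
  transitivity (polyK K a ^+ 2 * polyK K b ^+ 2 - 4%:R * polyK K b ^+ 3
    - 4%:R * polyK K a ^+ 3 * constK K c - 27%:R * constK K c ^+ 2
    + 18%:R * polyK K a * polyK K b * constK K c).
    by rewrite /constK; ring.
  by rewrite Da Db Dc; ring.
have p_gt2 : (2 < p)%N by lia.
(* The quartic has size 5, which is odd and at most [p] because [p > 5]. *)
have [||R monR DR] := comp_square_is_square charF p_gt2 (monic_disc_poly c d) _ _ a_gt1 Dw.
- by rewrite size_disc_poly ltnW.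
- by rewrite size_disc_poly.
have nz2 : 2%:R != 0 :> F by rewrite -(dvdn_pcharf charF) gtnNdvd.
have [-> Dd] := disc_poly_square nz2 nz_c monR DR.
by rewrite Dbd Dd rmorphN rmorph_nat.
Qed.

End CyclicCubic.

(** The degree of [x] divides the prime dimension and is not 1, so it equals it. The minimal
    polynomial then divides a monic [q] of the same degree. *)
Lemma minPoly_prime_degree (F0 : fieldType) (L : fieldExtType F0) (x : L) q :
    prime (\dim {:L}) -> x \notin 1%VS -> q \is a polyOver 1%VS ->
    q \is monic -> size q = (\dim {:L}).+1 -> root q x ->
  minPoly 1 x = q /\ <<1; x>>%VS = {:L}%VS.
Proof.
move=> primeL F'x Fq mon_q sz_q rt_q.
have deg_dim := dim_Fadjoin 1 x; rewrite dimv1 muln1 in deg_dim.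
have deg_x : adjoin_degree 1 x = \dim {:L}.
  apply/(prime_nt_dvdP primeL); first by rewrite adjoin_deg_eq1.
  by rewrite -deg_dim field_dimS ?subvf.
split; last by apply/eqP; rewrite eqEdim subvf deg_dim deg_x leqnn.
apply/eqP; rewrite -eqp_monic ?monic_minPoly // -dvdp_size_eqp ?minPoly_dvdp //.
by rewrite size_minPoly deg_x sz_q.
Qed.

Theorem theorem3p1 (F : finFieldType) (p : nat)
    (charF : p \in [pchar F]) (p_gt5 : (5 < p)%N)
    (K : splittingFieldType (ratfun F))
    (cubicK : \dim {:K} = 3%N) (galoisK : galois 1 {:K})
    (constantsK : full_constant_field K) (rankK : has_unit_rank K 2)
    (eps : K) (P A0 : {poly F}) (c k : F)
    (degP : (1 < size P)%N) (degA0 : (1 < size A0)%N) (c_neq0 : c != 0)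
    (eps_root : root (map_poly (@polyK F K)
                       ('X^3 + P *: 'X^2 + A0 *: 'X + (c%:P)%:P)) eps)
    (eps_exceptional : exceptional_pair k eps (eps + constK K k))
    (eps_nonconst : ~ range (@constK F K) eps)
    (epsk_nonconst : ~ range (@constK F K) (eps + constK K k)) :
  exists (A : {poly F}) (eta : K),
    [/\ (1 < size A)%N,
        minPoly 1 eta =
          map_poly (@polyK F K)
            ('X^3 - A *: 'X^2 - (A + 3%:R) *: 'X - 1)
      & <<1; eta>>%VS = {:K}%VS].
Proof.
have [nz_k u_eps u_epsk _] := eps_exceptional.
have nz_kV : k^-1 != 0 by rewrite invr_eq0.
pose kK := constK K k; have nz_kK : kK != 0 by case: (order_unit_const K nz_k).
pose eta := eps / kK; have Deps : eps = eta * kK by rewrite divfK.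
have u_kV := order_unit_const K nz_kV; rewrite constKV in u_kV.
have u_eta : order_unit eta by apply: order_unitM.
have u_eta1 : order_unit (eta + 1).
  have -> : eta + 1 = (eps + kK) / kK by rewrite mulrDl divff.
  exact: order_unitM.
(* A unit lying in [F(t)] would be constant. *)
have F'eps : eps \notin 1%VS.
  apply/negP=> Feps; have [a _ Da] := order_unit_in1 u_eps Feps.
  by apply: eps_nonconst; exists a.
have F'eta : eta \notin 1%VS.
  by apply: contra F'eps => Feta; rewrite Deps rpredM ?polyK_in1.
(* Dividing the root by [k] divides the three coefficients by [k], [k ^+ 2] and [k ^+ 3], without
   changing their degrees. *)
pose a : {poly F} := k^-1 *: P; have DP : polyK K P = polyK K a * kK.
  by rewrite -rmorphM /= /a mulrC mul_polyC scalerA divff // scale1r.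
have a_gt1 : (1 < size a)%N by rewrite size_scale.
pose b : {poly F} := k^-1 ^+ 2 *: A0; have DA0 : polyK K A0 = polyK K b * kK ^+ 2.
  rewrite -rmorphXn -rmorphM /= /b mulrC -polyC_exp mul_polyC scalerA.
  by rewrite -exprMn divff // expr1n scale1r.
pose c1 := c / k ^+ 3; have Dc : constK K c = constK K c1 * kK ^+ 3.
  rewrite -rmorphXn -rmorphM /= -polyC_exp -polyCM /c1 divfK //.
  by rewrite expf_neq0.
have nz_c1 : c1 != 0 by rewrite mulf_neq0 ?invr_eq0 ?expf_neq0.
have rt_eps : eps ^+ 3 + polyK K P * eps ^+ 2 + polyK K A0 * eps + constK K c = 0.
  move/rootP: eps_root; rewrite !rmorphD /= !map_polyZ /= !map_polyXn map_polyX.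
  by rewrite map_polyC /= !(hornerD, hornerZ, hornerXn, hornerX, hornerC).
have rt_eta : eta ^+ 3 + polyK K a * eta ^+ 2 + polyK K b * eta + constK K c1 = 0.
  apply: (mulIf (expf_neq0 3 nz_kK)).
  by rewrite mul0r -[RHS]rt_eps DP DA0 Dc Deps; ring.
have [Db Dc1] := exceptional_unit_simplest charF p_gt5 cubicK galoisK u_eta u_eta1
  F'eta a_gt1 nz_c1 rt_eta.
(* With [A = - a], the relation [b = a - 3] reads [b = - (A + 3)]. *)
exists (- a), eta; rewrite size_polyN.
set q : {poly {poly F}} := _ - 1.
have Dq : q = 'X^3 + Poly [:: - 1%:P; b; a].
  rewrite /q /= !cons_poly_def Db -!mul_polyC; ring.
have sz_tail : (size (Poly [:: - 1%:P; b; a]) < size ('X^3 : {poly {poly F}}))%N.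
  by rewrite size_polyXn ltnS (size_Poly [:: _; _; _]).
have mon_q : q \is monic by rewrite Dq monicE lead_coefDl ?lead_coefXn.
have [||||||-> ->] // := @minPoly_prime_degree _ K eta (map_poly (@polyK F K) q).
- by rewrite cubicK.
- by apply/polyOverP=> i; rewrite coef_map polyK_in1.
- exact: monic_map.
- rewrite size_map_inj_poly ?rmorph0 //; last exact: polyK_inj.
  by rewrite Dq size_polyDl // size_polyXn cubicK.
apply/rootP; rewrite -[RHS]rt_eta Db Dc1 /q !rmorphB /= !map_polyZ /=.
rewrite map_polyX !map_polyXn rmorph1 !(hornerD, hornerN, hornerZ).
rewrite !(hornerXn, hornerX, hornerC) /constK.
by ring.
Qed.
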